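(* Assume $n$ is a power of two and $\varepsilon\in(0,\tfrac12)$. Let $\hat V_t:S\to\mathbb R$ for $t=0,\dots,n$ be given, and let $\beta=\max_{s,t}|V_t(s)-\hat V_t(s)|$. Let $D$ be the distribution returned by FOOL$(\varepsilon)$ run with these vectors $\hat V_t$. Then for every state $s\in S$, $$|T_D(s,W)-T_\Omega(s,W)|\le\varepsilon\,\mathfrak V(s)+3\beta n.$$
   Context: Fix independent finitely supported distributions $\Omega_0,\dots,\Omega_{n-1}$; $\Omega_{t,t'}=\Omega_t\times\cdots\times\Omega_{t'-1}$, $\Omega=\Omega_{0,n}$; $\vec r\in\Omega_{t,t'}$ means $\vec r=(r_t,\dots,r_{t'-1})$ with each $r_j$ in the support of $\Omega_j$. An automaton has finite state set $S$ and transition map $F$; $F(\vec r,s)$ is the state reached from $s$ after reading $\vec r$. For a distribution $D$ on drivestreams and $w:S\to\mathbb R$, $T_D(s,w)=\mathbb E_{\vec r\sim D}[w(F(\vec r,s))]$; $T_{t,t'}=T_{\Omega_{t,t'}}$, $T_\Omega=T_{0,n}$. $W:S\to\mathbb R$ is a final weight function and $V_t(s)=T_{t,n}(s,W)$. Sensitivity: $\alpha(s,w,E)=\max_{\vec r}w(F(\vec r,s))-\min_{\vec r}w(F(\vec r,s))$ over $\vec r$ in the support of $E$. Confusion: $\mathfrak C(s,t)=\max_{r_1,r_2\in\mathrm{supp}\,\Omega_t}|T_{t+1,n}(F(r_1,s),W)-T_{t+1,n}(F(r_2,s),W)|$; total variability $\mathfrak V(s)=\sum_{t=0}^{n-1}\max_{\vec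 r\in\Omega_{0,t}}\mathfrak C(F(\vec r,s),t)$. REDUCE is any procedure that, given a distribution $E$ on drivestreams, a parameter $\delta$ and $w:S\to\mathbb R$, returns a distribution $D'$ supported on drivestreams from the support of $E$ with $|T_{D'}(s,w)-T_E(s,w)|\le\delta\,\alpha(s,w,E)$ for all $s\in S$. For distributions $D^1,D^2$ on consecutive windows, $D^1\times D^2$ is the product distribution on concatenated drivestreams. FOOL$(\varepsilon)$: set $D_{0,t}=\Omega_t$ for $t=0,\dots,n-1$; for $i=0,\dots,\lg n-1$, with $h=2^i$, for every $t\in\{0,2h,4h,\dots,n-2h\}$ set $D_{i+1,t}=\mathrm{REDUCE}(D_{i,t}\times D_{i,t+h},\delta,\hat V_{t+2h})$ where $\delta=\frac{\varepsilon}{20(1+\lg n)}$; return $D=D_{\lg n,0}$. *)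

(* Defs.v *)
From HB Require Import structures.
From mathcomp Require Export all_boot all_order all_algebra finmap.

Set Implicit Arguments.
Unset Strict Implicit.
Unset Printing Implicit Defensive.

Import Order.TTheory GRing.Theory Num.Theory.
Local Open Scope ring_scope.
Local Open Scope fset_scope.

Section Extrema.
Variable R : realFieldType.

(* Supports of distributions are nonempty, so as soon as there is a state every
   list to which these are applied below is nonempty and the default 0 of [head]
   is never reached. *)
Definition maxs (l : seq R) : R := \big[Num.max/head 0 l]_(x <- l) x.
Definition mins (l : seq R) : R := \big[Num.min/head 0 l]_(x <- l) x.

End Extrema.

Record dist (R : realFieldType) (T : choiceType) := Dist {
  mass :> {fsfun T -> R with 0};
  mass_ge0 : forall x, 0 <= mass x;
  mass_sum1 : \sum_(x <- finsupp mass) mass x = 1 }.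

Definition supp (R : realFieldType) (T : choiceType) (D : dist R T) : {fset T} :=
  finsupp (mass D).

Definition expect (R : realFieldType) (T : choiceType) (D : dist R T)
    (f : T -> R) : R :=
  \sum_(x <- supp D) D x * f x.

Section Constructions.
Variable R : realFieldType.

Lemma sum_fsfun_incl (T : choiceType) (f : {fsfun T -> R with 0}) (A : {fset T}) :
  finsupp f `<=` A -> \sum_(x <- finsupp f) f x = \sum_(x <- A) f x.
Proof.
by move=> sfA; apply: big_fset_incl => // x _ /fsfun_dflt.
Qed.

Lemma sum_fsfun_in (T : choiceType) (A : {fset T}) (g : T -> R) :
  \sum_(x <- finsupp [fsfun x in A => g x | 0]) [fsfun x in A => g x | 0] x
  = \sum_(x <- A) g x.
Proof.
rewrite (@sum_fsfun_incl _ _ A); last exact: finsupp_sub.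
by rewrite big_seq [RHS]big_seq; apply: eq_bigr => x xA; rewrite fsfunE xA.
Qed.

Section Dirac.
Variables (T : choiceType) (a : T).

Definition dirac_mass : {fsfun T -> R with 0} := [fsfun x in [fset a] => 1 | 0].

Lemma dirac_ge0 x : 0 <= dirac_mass x.
Proof. by rewrite fsfunE; case: ifP. Qed.

Lemma dirac_sum1 : \sum_(x <- finsupp dirac_mass) dirac_mass x = 1.
Proof. by rewrite sum_fsfun_in big_seq_fset1. Qed.

Definition ddirac : dist R T := Dist dirac_ge0 dirac_sum1.
End Dirac.

Section Product.
Variables (T1 T2 : choiceType) (D1 : dist R T1) (D2 : dist R T2).

Definition prod_mass : {fsfun T1 * T2 -> R with 0} :=
  [fsfun p in supp D1 `*` supp D2 => D1 p.1 * D2 p.2 | 0].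

Lemma prod_ge0 p : 0 <= prod_mass p.
Proof. by rewrite fsfunE; case: ifP => // _; rewrite mulr_ge0 ?mass_ge0. Qed.

Lemma prod_sum1 : \sum_(p <- finsupp prod_mass) prod_mass p = 1.
Proof.
rewrite sum_fsfun_in big_imfset2 /=; last by move=> [? ?] [? ?] _ _ [-> ->].
rewrite -[RHS](mass_sum1 D1); apply: eq_bigr => x _.
by rewrite -big_distrr /= mass_sum1 mulr1.
Qed.

Definition dprod : dist R (T1 * T2)%type := Dist prod_ge0 prod_sum1.
End Product.

Section Image.
Variables (T U : choiceType) (f : T -> U) (D : dist R T).

Definition image_mass : {fsfun U -> R with 0} :=
  [fsfun y in f @` supp D => \sum_(x <- supp D | f x == y) D x | 0].

Lemma image_ge0 y : 0 <= image_mass y.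
Proof.
rewrite fsfunE; case: ifP => // _.
by apply: sumr_ge0 => x _; exact: mass_ge0.
Qed.

Lemma image_sum1 : \sum_(y <- finsupp image_mass) image_mass y = 1.
Proof. by rewrite sum_fsfun_in -partition_big_imfset /= mass_sum1. Qed.

Definition dimage : dist R U := Dist image_ge0 image_sum1.
End Image.

End Constructions.

Section Automaton.
Variables (R : realFieldType) (A : choiceType) (S : finType).

(* Drivestreams are words over [A]. The law of a word over a window is obtained
   from the product law of its two halves by concatenation. *)
Definition dcat (D1 D2 : dist R (seq A)) : dist R (seq A) :=
  dimage (fun p => p.1 ++ p.2) (dprod D1 D2).

Definition dletter (D : dist R A) : dist R (seq A) := dimage (fun a => [:: a]) D.

(* Omega_t x ... x Omega_{t'-1}; the point mass at the empty word if t' <= t. *)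
Definition window (Omega : nat -> dist R A) (t t' : nat) : dist R (seq A) :=
  foldr (fun j D => dcat (dletter (Omega j)) D) (ddirac R [::])
    (iota t (t' - t)).

Variable F : A -> S -> S.

Definition run (r : seq A) (s : S) : S := foldl (fun s a => F a s) s r.

Definition transition (D : dist R (seq A)) (s : S) (w : S -> R) : R :=
  expect D (fun r => w (run r s)).

Definition sensitivity (s : S) (w : S -> R) (E : dist R (seq A)) : R :=
  maxs [seq w (run r s) | r <- supp E] - mins [seq w (run r s) | r <- supp E].

(* Restricted to delta > 0: no procedure can meet the bound for delta < 0. *)
Definition is_REDUCE
    (reduce : dist R (seq A) -> R -> (S -> R) -> dist R (seq A)) : Prop :=
  forall (E : dist R (seq A)) (delta : R) (w : S -> R), 0 < delta ->
    supp (reduce E delta w) `<=` supp E /\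
    forall s, `|transition (reduce E delta w) s w - transition E s w|
              <= delta * sensitivity s w E.

Section Timed.
(* Only [Omega t] for t < n is used. *)
Variables (n : nat) (Omega : nat -> dist R A) (W : S -> R).

Definition value (t : nat) (s : S) : R := transition (window Omega t n) s W.

Definition confusion (s : S) (t : nat) : R :=
  maxs [seq `| transition (window Omega t.+1 n) (F r1 s) W
               - transition (window Omega t.+1 n) (F r2 s) W |
       | r1 <- supp (Omega t), r2 <- supp (Omega t)].

Definition variability (s : S) : R :=
  \sum_(t < n) maxs [seq confusion (run r s) t | r <- supp (window Omega 0 t)].

Definition estimate_error (Vhat : nat -> S -> R) : R :=
  maxs [seq `|value t s - Vhat t s| | t <- iota 0 n.+1, s <- enum S].

Variable reduce : dist R (seq A) -> R -> (S -> R) -> dist R (seq A).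
Variable Vhat : nat -> S -> R.

(* D_{i,t}; the recursion is meaningful for t a multiple of 2^i with
   t + 2^i <= n, and these are the only entries D_{lg n,0} depends on. *)
Fixpoint fool_dist (delta : R) (i t : nat) : dist R (seq A) :=
  if i is j.+1 then
    let h := (2 ^ j)%N in
    reduce (dcat (fool_dist delta j t) (fool_dist delta j (t + h)%N))
           delta (Vhat (t + 2 * h)%N)
  else dletter (Omega t).

(* [trunc_log 2 n] is lg n when n is a power of two. *)
Definition FOOL (eps : R) : dist R (seq A) :=
  fool_dist (eps / (20%:R * (1 + (trunc_log 2 n)%:R))) (trunc_log 2 n) 0.

End Timed.
End Automaton.

(* Main.v *)
Require Import Defs.
From mathcomp Require Import all_boot all_order all_algebra finmap.
From mathcomp Require Import ring lra.
Import Order.TTheory GRing.Theory Num.Theory.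
Local Open Scope ring_scope.

Set Implicit Arguments.
Unset Strict Implicit.
Unset Printing Implicit Defensive.

(** Let [Var t h s] be the part of the total variability of [s] coming from the
    window [t, t + h). Reading [r] from the support of [Omega_{t,t+a}] and then
    [b] further letters gives [Var t a s + Var (t + a) b (F r s) <= Var t (a + b) s].
    Since [V_u] is an average of [V_{u+1}], each letter read moves the value by at
    most the confusion, so [V_{t+h}] varies by at most [Var t h s] around [V_t s],
    and the sensitivity at a REDUCE step is at most [2 (Var + beta)]. Hence, by
    induction on the level [i], with [h = 2^i],
      [|T_{D_{i,t}}(s, V_{t+h}) - V_t s|
         <= 2 i delta Var t h s + (2 + 2 delta) (h - 1) beta],
    and [i = lg n] gives the bound because [2 delta lg n <= eps] and
    [2 + 2 delta <= 3]. *)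

(** * Bounds on maxima and minima of finite lists *)

Section ExtremaBounds.
Context {R : realFieldType}.
Implicit Types (l : seq R) (x M : R).

Lemma le_maxs l x : x \in l -> x <= maxs l.
Proof. by move=> xl; apply: le_bigmax_seq. Qed.

Lemma ge_mins l x : x \in l -> mins l <= x.
Proof. by move=> xl; apply: ge_bigmin_seq. Qed.

(** The default [head 0 l] must be bounded by [M] too; for nonempty [l] it is an element of [l]. *)
Lemma maxs_le l M : l != [::] -> {in l, forall x, x <= M} -> maxs l <= M.
Proof.
case: l => // a l _ H; rewrite /maxs big_seq.
by apply: bigmax_le => [|x xl]; apply: H; rewrite ?mem_head.
Qed.

Lemma le_mins l M : l != [::] -> {in l, forall x, M <= x} -> M <= mins l.
Proof.
case: l => // a l _ H; rewrite /mins big_seq.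
by apply: le_bigmin => [|x xl]; apply: H; rewrite ?mem_head.
Qed.

End ExtremaBounds.

(** * Expectations and supports of point masses, products and images *)

Section Distributions.
Context {R : realFieldType}.

Lemma supp_neq0 {T : choiceType} (D : dist R T) : (supp D : seq T) != [::].
Proof.
apply/eqP => D0; have := mass_sum1 D.
by rewrite -/(supp D) D0 big_nil => /eqP; rewrite eq_sym oner_eq0.
Qed.

Lemma expect_cst {T : choiceType} (D : dist R T) c : expect D (fun=> c) = c.
Proof. by rewrite /expect -mulr_suml mass_sum1 mul1r. Qed.

Lemma expect_dist_le {T : choiceType} (D : dist R T) (f g : T -> R) M :
  {in supp D, forall x, `|f x - g x| <= M} -> `|expect D f - expect D g| <= M.
Proof.
move=> fgM; rewrite -sumrB -[leRHS](expect_cst D).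
apply: (le_trans (ler_norm_sum _ _ _)).
rewrite /expect big_seq [leRHS]big_seq; apply: ler_sum => x xD.
by rewrite -mulrBr normrM ger0_norm ?mass_ge0 // ler_wpM2l ?mass_ge0 ?fgM.
Qed.

(** Common form of the masses of [ddirac], [dprod] and [dimage]: points of [B] where [g] vanishes
    leave the [finsupp] but add nothing to the sum. *)
Lemma expect_fsfun_in {T : choiceType} (B : {fset T}) (g f : T -> R) :
  \sum_(x <- finsupp [fsfun x in B => g x | 0]) [fsfun x in B => g x | 0] x * f x
  = \sum_(x <- B) g x * f x.
Proof.
rewrite (@big_fset_incl _ _ _ _ _ B); first last.
- by move=> x _ /fsfun_dflt ->; rewrite mul0r.
- exact: finsupp_sub.
by rewrite big_seq [RHS]big_seq; apply: eq_bigr => x xB; rewrite fsfunE xB.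
Qed.

Lemma expect_ddirac {T : choiceType} (a : T) f : expect (ddirac R a) f = f a.
Proof. by rewrite /expect expect_fsfun_in big_seq_fset1 mul1r. Qed.

Lemma expect_dprod {T1 T2 : choiceType} (D1 : dist R T1) (D2 : dist R T2) f :
  expect (dprod D1 D2) f = expect D1 (fun x => expect D2 (fun y => f (x, y))).
Proof.
rewrite /expect expect_fsfun_in big_imfset2 /=; last by move=> [? ?] [? ?] _ _ [-> ->].
apply: eq_bigr => x _; rewrite mulr_sumr; apply: eq_bigr => y _.
by rewrite mulrA.
Qed.

Lemma expect_dimage {T U : choiceType} (h : T -> U) (D : dist R T) f :
  expect (dimage h D) f = expect D (f \o h).
Proof.
rewrite /expect expect_fsfun_in.
rewrite [RHS](partition_big_imfset _ h) /=; apply: eq_bigr => y _.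
by rewrite mulr_suml; apply: eq_bigr => x /eqP ->.
Qed.

Lemma supp_dprod {T1 T2 : choiceType} (D1 : dist R T1) (D2 : dist R T2) p :
  (p \in supp (dprod D1 D2)) = (p.1 \in supp D1) && (p.2 \in supp D2).
Proof.
rewrite /supp mem_finsupp fsfunE inE.
case: ifP => [/andP[]|]; last by rewrite eqxx.
by rewrite !mem_finsupp => ? ?; rewrite mulf_neq0.
Qed.

(** Masses are nonnegative, so they cannot cancel in the sum over a fibre of [h]. *)
Lemma supp_dimage {T U : choiceType} (h : T -> U) (D : dist R T) :
  supp (dimage h D) = (h @` supp D)%fset.
Proof.
apply/fsetP => y; rewrite /supp mem_finsupp fsfunE.
case: ifP => [/imfsetP[/= x xD ->]|]; last by rewrite eqxx.
rewrite psumr_neq0 => [|z _]; last exact: mass_ge0.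
apply/hasP; exists x => //; rewrite eqxx /= lt_neqAle mass_ge0 andbT eq_sym.
by move: xD; rewrite mem_finsupp.
Qed.

Lemma supp_ddirac {T : choiceType} (a : T) : supp (ddirac R a) = [fset a]%fset.
Proof.
apply/fsetP => y; rewrite /supp mem_finsupp fsfunE inE.
by case: ifP; rewrite ?oner_eq0 ?eqxx.
Qed.

Lemma supp_dcatP {A : choiceType} (D1 D2 : dist R (seq A)) r :
  reflect (exists r1 r2, [/\ r1 \in supp D1, r2 \in supp D2 & r = r1 ++ r2])
          (r \in supp (dcat D1 D2)).
Proof.
rewrite supp_dimage; apply: (iffP (imfsetP _ _ _ _)) => /=.
- by case=> -[r1 r2]; rewrite supp_dprod => /andP[/= ? ?] ->; exists r1, r2.
- by case=> r1 [r2 [? ? ->]]; exists (r1, r2); rewrite ?supp_dprod //=; apply/andP.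
Qed.

End Distributions.

(** * Words over consecutive windows *)

Section Windows.
Context {R : realFieldType} {A : choiceType}.
Variable Omega : nat -> dist R A.

Lemma window_nil t : window Omega t t = ddirac R [::].
Proof. by rewrite /window subnn. Qed.

Lemma window_recl t t' : (t < t')%N ->
  window Omega t t' = dcat (dletter (Omega t)) (window Omega t.+1 t').
Proof. by move=> tt'; rewrite /window -(subnSK tt'). Qed.

Lemma supp_window_cons t t' r : (t < t')%N -> r \in supp (window Omega t t') ->
  exists a r', [/\ a \in supp (Omega t), r' \in supp (window Omega t.+1 t')
                 & r = a :: r'].
Proof.
move=> tt'; rewrite window_recl // => /supp_dcatP[r1 [r' [+ r'W ->]]].
by rewrite supp_dimage => /imfsetP[/= a aO ->]; exists a, r'.
Qed.

Lemma cons_supp_window t t' a r : (t < t')%N -> a \in supp (Omega t) ->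
  r \in supp (window Omega t.+1 t') -> a :: r \in supp (window Omega t t').
Proof.
move=> tt' aO rW; rewrite window_recl //; apply/supp_dcatP.
by exists [:: a], r; rewrite supp_dimage in_imfset.
Qed.

Lemma cat_supp_window t a b r1 r2 :
  r1 \in supp (window Omega t (t + a)) ->
  r2 \in supp (window Omega (t + a) (t + a + b)) ->
  r1 ++ r2 \in supp (window Omega t (t + a + b)).
Proof.
elim: a t r1 => [|a IH] t r1.
  by rewrite addn0 window_nil supp_ddirac inE => /eqP ->.
move=> /supp_window_cons[|x [r [xO rW ->]] r2W].
  by rewrite addnS ltnS leq_addr.
rewrite cat_cons cons_supp_window //; first by rewrite -addnA addSn addnS ltnS leq_addr.
by move: rW r2W; rewrite -addSnnS; exact: IH.
Qed.

End Windows.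

(** * Transitions and sensitivity *)

Section Automaton.
Context {R : realFieldType} {A : choiceType} {S : finType}.
Variable F : A -> S -> S.

Lemma run_cat r1 r2 s : run F (r1 ++ r2) s = run F r2 (run F r1 s).
Proof. exact: foldl_cat. Qed.

Lemma transition_dcat (D1 D2 : dist R (seq A)) s w :
  transition F (dcat D1 D2) s w = expect D1 (fun r => transition F D2 (run F r s) w).
Proof.
rewrite /transition expect_dimage expect_dprod /expect /=.
apply: eq_bigr => r1 _; congr (_ * _); apply: eq_bigr => r2 _.
by rewrite run_cat.
Qed.

Lemma transition_dletter (D : dist R A) s w :
  transition F (dletter D) s w = expect D (fun a => w (F a s)).
Proof. by rewrite /transition expect_dimage. Qed.

Lemma sensitivity_le s (w : S -> R) (E : dist R (seq A)) c M :
  {in supp E, forall r, `|w (run F r s) - c| <= M} ->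
  sensitivity F s w E <= M *+ 2.
Proof.
move=> wM; rewrite /sensitivity.
have nz : [seq w (run F r s) | r <- supp E] != [::].
  by rewrite -size_eq0 size_map size_eq0 supp_neq0.
have : maxs [seq w (run F r s) | r <- supp E] <= c + M.
  by apply: maxs_le => // _ /mapP[r /wM + ->]; rewrite ler_distl => /andP[].
have : c - M <= mins [seq w (run F r s) | r <- supp E].
  by apply: le_mins => // _ /mapP[r /wM + ->]; rewrite ler_distl => /andP[].
by lra.
Qed.

(** * Values, confusion and variability over a window *)

Section Timed.
Variables (n : nat) (Omega : nat -> dist R A) (W : S -> R).

Local Notation V := (value F n Omega W).

Lemma value_end s : V n s = W s.
Proof. by rewrite /value window_nil /transition expect_ddirac. Qed.

Lemma value_step t s : (t < n)%N ->
  V t s = expect (Omega t) (fun a => V t.+1 (F a s)).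
Proof.
by move=> tn; rewrite /value window_recl // transition_dcat expect_dimage.
Qed.

Lemma value_confusion t s a : (t < n)%N -> a \in supp (Omega t) ->
  `|V t.+1 (F a s) - V t s| <= confusion F n Omega W s t.
Proof.
(* The constant [V t.+1 (F a s)] becomes its own expectation over [Omega t], so the comparison is
   letter by letter. *)
move=> tn aO; rewrite (value_step s tn) -[V t.+1 _](expect_cst (Omega t)).
apply: expect_dist_le => b bO; apply: le_maxs.
by apply/allpairsP; exists (a, b).
Qed.

(** Here [s] is the state at time [t]; for [t = 0] and [h = n] the sum is convertible to
    [variability]. *)
Definition window_variability t h s : R :=
  \sum_(u < h) maxs [seq confusion F n Omega W (run F r s) (t + u)
                    | r <- supp (window Omega t (t + u))].

(** The first [a] terms agree. In the others, prefixing [r] turns each word on the left into one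
    over which the right-hand maximum ranges. *)
Lemma window_variability_cat t a b s r : r \in supp (window Omega t (t + a)) ->
  window_variability t a s + window_variability (t + a) b (run F r s)
  <= window_variability t (a + b) s.
Proof.
move=> rW; rewrite /window_variability big_split_ord /= lerD2l.
apply: ler_sum => u _; rewrite addnA.
apply: maxs_le => [|_ /mapP[r' r'W ->]].
  by rewrite -size_eq0 size_map size_eq0 supp_neq0.
apply: le_maxs; apply/mapP; exists (r ++ r'); rewrite ?run_cat //.
exact: cat_supp_window.
Qed.

Lemma confusion_le_variability1 t s :
  confusion F n Omega W s t <= window_variability t 1 s.
Proof.
rewrite /window_variability big_ord1 addn0 window_nil supp_ddirac.
by apply: le_maxs; apply/mapP; exists [::]; rewrite ?inE.
Qed.

Lemma value_variation t h s r : (t + h <= n)%N ->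
  r \in supp (window Omega t (t + h)) ->
  `|V (t + h) (run F r s) - V t s| <= window_variability t h s.
Proof.
elim: h t s r => [|h IH] t s r thn.
  rewrite addn0 window_nil supp_ddirac inE => /eqP ->.
  by rewrite subrr normr0 /window_variability big_ord0.
have tn : (t < n)%N by apply: leq_trans thn; rewrite addnS ltnS leq_addr.
move=> /supp_window_cons[|a [r' [aO r'W ->]]]; first by rewrite addnS ltnS leq_addr.
apply: le_trans (ler_distD (V t.+1 (F a s)) _ _) _.
(* The window is split as [1 + h] with prefix [[:: a]]: the first letter costs one confusion, the
   rest is the induction hypothesis. *)
have aW : [:: a] \in supp (window Omega t (t + 1)).
  by rewrite cons_supp_window ?addn1 // window_nil supp_ddirac inE.
have := @window_variability_cat t 1 h s _ aW.
rewrite add1n; apply: le_trans; rewrite addrC lerD //.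
  exact: le_trans (value_confusion _ _ _) (confusion_le_variability1 _ _).
by rewrite addn1 -addSnnS; apply: (IH t.+1 (F a s) r'); rewrite addSnnS.
Qed.

(** * Error propagation through the levels of [FOOL] *)

Variables (reduce : dist R (seq A) -> R -> (S -> R) -> dist R (seq A)).
Hypothesis reduceP : is_REDUCE F reduce.
Variables (Vhat : nat -> S -> R) (delta : R).
Hypothesis delta_gt0 : 0 < delta.

Local Notation beta := (estimate_error F n Omega W Vhat).
Local Notation D := (fool_dist Omega reduce Vhat delta).

Lemma estimate_errorP t s : (t <= n)%N -> `|V t s - Vhat t s| <= beta.
Proof.
move=> tn; apply: le_maxs; apply/allpairsP; exists (t, s).
by rewrite mem_iota mem_enum.
Qed.

Lemma transition_estimate (E : dist R (seq A)) t s : (t <= n)%N ->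
  `|transition F E s (V t) - transition F E s (Vhat t)| <= beta.
Proof. by move=> tn; apply: expect_dist_le => r _; apply: estimate_errorP. Qed.

(** REDUCE keeps only words of its input, so bounds over words of the true windows apply to words of
    [D]. *)
Lemma supp_fool_dist i t r :
  r \in supp (D i t) -> r \in supp (window Omega t (t + 2 ^ i)).
Proof.
elim: i t r => [|i IH] t r /=.
  rewrite supp_dimage addn1 => /imfsetP[/= a aO ->].
  by rewrite cons_supp_window // window_nil supp_ddirac inE.
have [/fsubsetP sub _] := reduceP
  (dcat (D i t) (D i (t + 2 ^ i)%N)) (Vhat (t + 2 * 2 ^ i)%N) delta_gt0.
move=> /sub/supp_dcatP[r1 [r2 [/IH r1W /IH r2W ->]]].
by rewrite expnS mul2n -addnn addnA cat_supp_window.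
Qed.

(** Merging two halves doubles the [beta] term and adds [(2 + 2 delta) beta], whence
    [2 (h - 1) + 1 = 2 h - 1]. The variabilities of the halves add up to at most that of the whole,
    so their coefficient grows only by [2 delta] per level. *)
Lemma fool_dist_error i t s : (t + 2 ^ i <= n)%N ->
  `|transition F (D i t) s (V (t + 2 ^ i)) - V t s|
  <= 2%:R * i%:R * delta * window_variability t (2 ^ i) s
     + (2%:R + 2%:R * delta) * ((2 ^ i)%:R - 1) * beta.
Proof.
elim: i t s => [|i IH] t s tn.
  rewrite expn0 addn1 in tn *.
  by rewrite transition_dletter -value_step // !subrr normr0 !(mulr0, mul0r) addr0.
rewrite expnS mul2n -addnn [fool_dist _ _ _ _ _ _]/= mul2n -addnn addnA in tn *.
set h := (2 ^ i)%N in tn IH *.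
set E := dcat _ _; set u := (t + h + h)%N.
have thn : (t + h <= n)%N by apply: leq_trans tn; rewrite leq_addr.
set Var := window_variability t (h + h) s.
(* Along words of [E], [V u] stays within [Var] of the centre [V t s], and [Vhat u] within [beta] of
   [V u]. *)
have sens : sensitivity F s (Vhat u) E <= (Var + beta) *+ 2.
  apply: (@sensitivity_le _ _ _ (V t s)) => r.
  case/supp_dcatP=> r1 [r2 [/supp_fool_dist r1W /supp_fool_dist r2W ->]].
  apply: le_trans (ler_distD (V u (run F (r1 ++ r2) s)) _ _) _.
  rewrite addrC lerD //; last by rewrite distrC estimate_errorP.
  by rewrite /u -addnA value_variation ?addnA // cat_supp_window.
have [_ /(_ s) red] := reduceP E (Vhat u) delta_gt0.
have est1 := @transition_estimate (reduce E delta (Vhat u)) u s tn.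
have est2 := @transition_estimate E u s tn.
have le_red := le_trans red (ler_wpM2l (ltW delta_gt0) sens).
set a : R := 2%:R * i%:R * delta in IH.
set b : R := _ * (h%:R - 1) * beta in IH.
have a_ge0 : 0 <= a by rewrite !mulr_ge0 // ltW.
(* The second half starts from the state reached by the first; the bound on its variability is
   uniform in that state. *)
have step2 : `|transition F E s (V u) - transition F (D i t) s (V (t + h))|
    <= a * (Var - window_variability t h s) + b.
  rewrite transition_dcat; apply: expect_dist_le => r /supp_fool_dist rW.
  apply: le_trans (IH _ _ tn) _; rewrite lerD2r ler_wpM2l // lerBrDl.
  exact: window_variability_cat.
have step1 := IH t s thn.
(* Five contributions: passing from [V u] to [Vhat u], reducing, passing back to [V u] under [E],
   the second half, the first half. *)
have -> : 2%:R * i.+1%:R * delta * Var + (2%:R + 2%:R * delta) * ((h + h)%:R - 1) * beta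
  = beta + delta * ((Var + beta) *+ 2) + beta
    + (a * (Var - window_variability t h s) + b)
    + (a * window_variability t h s + b).
  by rewrite /a /b natrD -natr1; ring.
move: est1 le_red est2 step2 step1; rewrite !ler_norml.
by lra.
Qed.

End Timed.
End Automaton.

Theorem mainTheorem8 (R : realFieldType) (A : choiceType) (S : finType)
    (F : A -> S -> S) (n : nat) (Omega : nat -> dist R A) (W : S -> R)
    (reduce : dist R (seq A) -> R -> (S -> R) -> dist R (seq A))
    (Hreduce : is_REDUCE F reduce)
    (Hn : exists k : nat, n = (2 ^ k)%N)
    (eps : R) (Heps : 0 < eps < 2%:R^-1)
    (Vhat : nat -> S -> R) (s : S) :
  let beta := estimate_error F n Omega W Vhat in
  let D := FOOL n Omega reduce Vhat eps in
  `| transition F D s W - transition F (window Omega 0 n) s W |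
  <= eps * variability F n Omega W s + 3%:R * beta * n%:R.
Proof.
set beta := estimate_error _ _ _ _ _; set D := FOOL _ _ _ _ _; lazy zeta.
have [k nE] := Hn; have /andP[eps_gt0 eps_lt] := Heps.
have kE : trunc_log 2 n = k by rewrite nE trunc_expnK.
pose d : R := 20%:R * (1 + k%:R).
have k_ge0 : 0 <= k%:R :> R by rewrite ler0n.
have d_gt0 : 0 < d by rewrite /d; lra.
have delta_gt0 : 0 < eps / d by rewrite divr_gt0.
have delta_d : eps / d * d = eps by rewrite divfK // gt_eqF.
have le_n : (0 + 2 ^ k <= n)%N by rewrite add0n nE.
have := @fool_dist_error _ _ _ F n Omega W _ Hreduce Vhat _ delta_gt0 k 0 s le_n.
have -> : fool_dist Omega reduce Vhat (eps / d) k 0 = D by rewrite /D /FOOL kE.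
rewrite add0n -nE -/beta.
have -> : window_variability F n Omega W 0 n s = variability F n Omega W s by [].
have -> : transition F D s (value F n Omega W n) = transition F D s W.
  by apply: eq_bigr => r _; rewrite value_end.
move/le_trans; apply.
(* The variability bounds an absolute value along any word of the full window. *)
have Var_ge0 : 0 <= variability F n Omega W s.
  have [r rW] : exists r, r \in supp (window Omega 0 (0 + n)).
    have := supp_neq0 (window Omega 0 (0 + n)).
    case E: (enum_fset _) => [//|r l] _; exists r.
    by have : r \in r :: l; [exact: mem_head | rewrite -E].
  exact: le_trans (normr_ge0 _) (@value_variation _ _ _ F n Omega W 0 n s r _ rW).
have beta_ge0 : 0 <= beta.
  exact: le_trans (normr_ge0 _) (@estimate_errorP _ _ _ F n Omega W Vhat n s _).
have n_ge1 : 1 <= n%:R :> R by rewrite ler1n nE expn_gt0.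
(* From [eps < 1/2] and [d >= 20]; it gives [2 + 2 delta <= 3]. *)
have delta_le : eps / d <= 2%:R^-1.
  by move: delta_d; rewrite /d; nra.
(* The coefficients are compared separately: [2 k <= d] for the variability, and
   [(2 + 2 delta) (n - 1) <= 3 n] for [beta]. *)
apply: lerD.
  by apply: ler_wpM2r => //; move: delta_d; rewrite /d; nra.
by rewrite [leRHS]mulrAC; apply: ler_wpM2r => //; nra.
Qed.
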